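(* Let $a,b\in\mathbb{R}^n$, assume that $b$ has distinct coordinates and that $a\notin\mathrm{Perm}(b)$. Then, for a vector $\hat c$, the following are equivalent: (i) $\hat c\in\mathrm{Perm}(b)$ satisfies $$a-\hat c\preceq a-c\qquad\forall c\in\mathrm{Perm}(b);$$ (ii) $\hat c$ is the closest point of $\mathrm{Perm}(b)$ to $a$; that is, $$\hat c=\arg\min_{c\in\mathrm{Perm}(b)}\|a-c\|_2.$$ Moreover the vector $\hat c$ is sorted as $a$: for all $i,j$, $a_i\le a_j$ implies $\hat c_i\le\hat c_j$.
   Context: For $b=(b_1,\dots,b_n)\in\mathbb{R}^n$ and a permutation $\sigma$ of $\{1,\dots,n\}$, write $b_\sigma=(b_{\sigma(1)},\dots,b_{\sigma(n)})$. $\mathrm{Perm}(b)$ (the permutahedron generated by $b$) is the convex hull of $\{b_\sigma:\sigma\in\mathcal{S}_n\}$, where $\mathcal{S}_n$ is the set of all permutations of $\{1,\dots,n\}$. Majorization: for $x,y\in\mathbb{R}^n$, $x\preceq y$ ($x$ is majorized by $y$) means that for every $j$ the sum of the $j$ largest components of $x$ is less than or equal to the sum of the $j$ largest components of $y$, and the total sums of the components of $x$ and $y$ are equal. $\|\cdot\|_2$ is the Euclidean norm. *)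

(* Defs.v *)
From HB Require Import structures.
From mathcomp Require Import all_boot all_order all_algebra perm.
From mathcomp Require Import classical_sets reals convex.
Set Implicit Arguments.
Unset Strict Implicit.
Unset Printing Implicit Defensive.
Import Order.TTheory GRing.Theory Num.Theory.
Local Open Scope classical_set_scope.
Local Open Scope ring_scope.

Definition conv_hull (R : realType) (n : nat) (A : set 'rV[R]_n) :
    set 'rV[R]_n :=
  smallest (fun C => convex_set (C : set (convex_lmodType 'rV[R]_n))) A.

(* [col_perm s b] is the vector (b_(s(1)), ..., b_(s(n))). *)
Definition permutahedron (R : realType) (n : nat) (b : 'rV[R]_n) :
    set 'rV[R]_n :=
  conv_hull [set col_perm s b | s in [set: 'S_n]].

Definition sum_largest (R : realType) (n : nat) (x : 'rV[R]_n) (j : nat) : R :=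
  \sum_(t <- take j (sort >=%R [seq x 0 i | i <- enum 'I_n])) t.

Definition majorized (R : realType) (n : nat) (x y : 'rV[R]_n) : Prop :=
  (forall j : nat, (1 <= j <= n)%N -> sum_largest x j <= sum_largest y j)
  /\ \sum_i x 0 i = \sum_i y 0 i.

(* The canonical norm [`|x|] on row vectors is the sup norm, hence this one. *)
Definition norm2 (R : realType) (n : nat) (x : 'rV[R]_n) : R :=
  Num.sqrt (\sum_i x 0 i ^+ 2).

Definition argmin (R : realType) (T : Type) (C : set T) (f : T -> R) : set T :=
  [set c | C c /\ forall c', C c' -> f c <= f c'].

(* Main.v *)
Require Import Defs.
From mathcomp Require Import all_boot all_order all_algebra perm.
From mathcomp Require Import classical_sets reals interval_inference.
From mathcomp Require Import ring lra.
Import Order.TTheory GRing.Theory Num.Theory.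
Local Open Scope classical_set_scope.
Local Open Scope ring_scope.

(** Write [P] for the permutahedron of [b] and [d := a - chat].

If [a - chat] is majorized by every [a - c], then it has the least Euclidean
norm among them, because the sum of squares is monotone for majorization
([majorized_dotp_le], by Abel summation along the decreasing rearrangements).
Conversely, a nearest point [chat] satisfies the first-order condition
[<d, c - chat> <= 0] for all [c] in [P] ([projection_dotp_le]), which also makes
it unique ([projection_unique]). So [chat] maximizes the linear form [d] over
[P]. A greedy argument special to permutahedra upgrades this: [chat] maximizes
over [P] the sum of the coordinates in each superlevel set [S] of [d]
([projection_superlevel_sum]).

Majorization is tested by the hinge sums [excess x t], the sum of
[max (x_i - t) 0] ([majorized_excess]). On [S = {d > t}] the point [chat] has
the largest possible coordinate sum, so the excess of [d], which is the sum over
[S] of [a - chat - t], is at most the same sum for any [c] in place of [chat],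
which in turn is at most the excess of [a - c] ([projection_majorized]).

The coordinates of [chat] are ordered like those of [a] because exchanging two
coordinates in the wrong order would give a point of [P] no farther from [a],
hence equal to [chat] by uniqueness. *)

(** * Euclidean geometry of row vectors *)

Definition dotp {R : realType} {n : nat} (x y : 'rV[R]_n) : R :=
  \sum_i x 0 i * y 0 i.

Lemma dotpC {R : realType} {n : nat} (x y : 'rV[R]_n) : dotp x y = dotp y x.
Proof. by apply: eq_bigr => i _; rewrite mulrC. Qed.

Lemma dotpDr {R : realType} {n : nat} (x y z : 'rV[R]_n) :
  dotp x (y + z) = dotp x y + dotp x z.
Proof. by rewrite -big_split; apply: eq_bigr => i _; rewrite mxE mulrDr. Qed.

Lemma dotpZr {R : realType} {n : nat} (k : R) (x y : 'rV[R]_n) :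
  dotp x (k *: y) = k * dotp x y.
Proof. by rewrite mulr_sumr; apply: eq_bigr => i _; rewrite mxE mulrCA. Qed.

Lemma dotpBr {R : realType} {n : nat} (x y z : 'rV[R]_n) :
  dotp x (y - z) = dotp x y - dotp x z.
Proof. by rewrite -scaleN1r dotpDr dotpZr mulN1r. Qed.

Lemma dotpBl {R : realType} {n : nat} (x y z : 'rV[R]_n) :
  dotp (x - y) z = dotp x z - dotp y z.
Proof. by rewrite !(dotpC _ z) dotpBr. Qed.

Lemma dotpZl {R : realType} {n : nat} (k : R) (x y : 'rV[R]_n) :
  dotp (k *: x) y = k * dotp x y.
Proof. by rewrite !(dotpC _ y) dotpZr. Qed.

Lemma dotp_ge0 {R : realType} {n : nat} (x : 'rV[R]_n) : 0 <= dotp x x.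
Proof. by apply: sumr_ge0 => i _; rewrite -expr2 sqr_ge0. Qed.

Lemma dotp_le0_eq0 {R : realType} {n : nat} (x : 'rV[R]_n) :
  dotp x x <= 0 -> x = 0.
Proof.
move=> x0; have /eqP : dotp x x = 0 by apply/eqP; rewrite eq_le x0 dotp_ge0.
rewrite psumr_eq0 => [|i _]; last by rewrite -expr2 sqr_ge0.
move=> /allP xi0; apply/rowP => i; rewrite mxE.
by have := xi0 i (mem_index_enum i); rewrite /= -expr2 sqrf_eq0 => /eqP.
Qed.

Lemma dotp_col_perm {R : realType} {n : nat} (s : 'S_n) (x y : 'rV[R]_n) :
  dotp (col_perm s x) (col_perm s y) = dotp x y.
Proof.
rewrite /dotp [RHS](reindex_inj (@perm_inj _ s)).
by apply: eq_bigr => i _; rewrite !mxE.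
Qed.

Lemma ler_norm2 {R : realType} {n : nat} (x y : 'rV[R]_n) :
  (norm2 x <= norm2 y) = (dotp x x <= dotp y y).
Proof.
have E (z : 'rV[R]_n) : norm2 z = Num.sqrt (dotp z z).
  by congr Num.sqrt; apply: eq_bigr => i _; rewrite expr2.
by rewrite !E ler_sqrt// dotp_ge0.
Qed.

(** The single computation behind both exchange arguments: uncrossing two
oppositely ordered coordinates can only increase the scalar product. *)
Lemma dotp_tperm {R : realType} {n : nat} (x y : 'rV[R]_n) (i j : 'I_n) :
  dotp x (col_perm (tperm i j) y) - dotp x y =
  (x 0 j - x 0 i) * (y 0 i - y 0 j).
Proof.
have [->|ij] := eqVneq i j.
  rewrite tperm1 [col_perm _ _](_ : _ = y) ?subrr ?mul0r//.
  by apply/rowP => k; rewrite mxE perm1.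
have ji : j != i by rewrite eq_sym.
rewrite /dotp (bigD1 i)// (bigD1 j)//= [\sum_k x 0 k * y 0 k](bigD1 i)//.
rewrite [X in _ - (_ + X)](bigD1 j)//= !mxE tpermL tpermR.
rewrite (eq_bigr (fun k => x 0 k * y 0 k)); first by ring.
by move=> k /andP[ki kj]; rewrite mxE tpermD// eq_sym.
Qed.

(** * The permutahedron as a convex, permutation-invariant set *)

Lemma permutahedron_vertex {R : realType} {n : nat} (b : 'rV[R]_n) (s : 'S_n) :
  permutahedron b (col_perm s b).
Proof. by apply: sub_gen_smallest; exists s. Qed.

Lemma permutahedron_min {R : realType} {n : nat} (b : 'rV[R]_n)
    (C : set 'rV[R]_n) :
  (forall x y t, 0 <= t <= 1 -> C x -> C y -> C (t *: x + (1 - t) *: y)) ->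
  (forall s, C (col_perm s b)) -> permutahedron b `<=` C.
Proof.
move=> convC vertC; apply: smallest_sub; last by move=> _ [s _ <-].
move=> x y t /set_mem Cx /set_mem Cy; apply/mem_set.
by apply: convC => //; rewrite ge0 le1.
Qed.

Lemma permutahedron_conv {R : realType} {n : nat} (b x y : 'rV[R]_n) (t : R) :
  0 <= t <= 1 -> permutahedron b x -> permutahedron b y ->
  permutahedron b (t *: x + (1 - t) *: y).
Proof.
move=> /andP[t0 t1] Px Py C [convC subC].
have Cx : C x by apply: Px.
have Cy : C y by apply: Py.
by have /set_mem := convC x y (Itv01 t0 t1) (mem_set Cx) (mem_set Cy).
Qed.

(** Half-spaces are convex, so a linear inequality on the hull needs checking
only at the permutations of [b]. *)
Lemma permutahedron_dotp_le {R : realType} {n : nat} (b w : 'rV[R]_n) (K : R) :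
  (forall s : 'S_n, dotp w (col_perm s b) <= K) ->
  forall c, permutahedron b c -> dotp w c <= K.
Proof.
move=> vertK; apply: permutahedron_min => // x y t /andP[t0 t1] xK yK.
rewrite dotpDr !dotpZr; apply: (@le_trans _ _ (t * K + (1 - t) * K)).
  by rewrite lerD// ler_wpM2l// subr_ge0.
by rewrite -mulrDl addrCA subrr addr0 mul1r.
Qed.

(** Permuting coordinates is linear and permutes the generators, so the
preimage of the hull under it is a convex set containing them. *)
Lemma permutahedron_col_perm {R : realType} {n : nat} (b c : 'rV[R]_n)
    (s : 'S_n) :
  permutahedron b c -> permutahedron b (col_perm s c).
Proof.
move: c; apply: permutahedron_min => [x y t t01 Px Py|u].
  by rewrite linearD !linearZ; exact: permutahedron_conv.
by rewrite -col_permM; exact: permutahedron_vertex.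
Qed.

(** An equality of linear forms is two inequalities, here for the weights [1]
and [-1]. *)
Lemma permutahedron_sum {R : realType} {n : nat} (b c : 'rV[R]_n) :
  permutahedron b c -> \sum_i c 0 i = \sum_i b 0 i.
Proof.
move=> Pc.
have dot1 (k : R) (x : 'rV[R]_n) : dotp (const_mx k) x = k * \sum_i x 0 i.
  by rewrite mulr_sumr; apply: eq_bigr => i _; rewrite mxE.
have vert (s : 'S_n) : \sum_i (col_perm s b) 0 i = \sum_i b 0 i.
  rewrite [RHS](reindex_inj (@perm_inj _ s)).
  by apply: eq_bigr => i _; rewrite mxE.
have le (k : R) : k * \sum_i c 0 i <= k * \sum_i b 0 i.
  rewrite -dot1; apply: permutahedron_dotp_le Pc => s.
  by rewrite dot1 vert.
by have := le 1; have := le (-1); lra.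
Qed.

(** * Partial sums of the decreasing rearrangement *)

Definition decr {R : realType} {n : nat} (x : 'rV[R]_n) : seq R :=
  sort >=%R [seq x 0 i | i <- enum 'I_n].

Lemma size_decr {R : realType} {n : nat} (x : 'rV[R]_n) : size (decr x) = n.
Proof. by rewrite size_sort size_map size_enum_ord. Qed.

Lemma big_decr {R : realType} {n : nat} (x : 'rV[R]_n) (f : R -> R) :
  \sum_(u <- decr x) f u = \sum_i f (x 0 i).
Proof. by rewrite (perm_big _ (permEl (perm_sort _ _))) big_map big_enum. Qed.

Lemma decr_sorted {R : realType} {n : nat} (x : 'rV[R]_n) (i j : nat) :
  (i <= j < n)%N -> nth 0 (decr x) j <= nth 0 (decr x) i.
Proof.
move=> /andP[ij jn].
have tr : transitive (>=%R : rel R) by move=> u v w vu wv; exact: le_trans wv vu.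
have srt : sorted >=%R (decr x) by apply: sort_sorted => u v; exact: le_total.
apply: (sorted_leq_nth tr (@lexx _ R) 0 srt) => //.
  by rewrite inE size_decr (leq_ltn_trans ij jn).
by rewrite inE size_decr.
Qed.

Lemma sum_largest_nth {R : realType} {n : nat} (x : 'rV[R]_n) (j : nat) :
  (j <= n)%N -> sum_largest x j = \sum_(0 <= k < j) nth 0 (decr x) k.
Proof.
move=> jn; rewrite /sum_largest (big_nth 0) size_takel ?size_decr//.
rewrite !big_nat; apply: eq_bigr => k /andP[_ kj].
by rewrite nth_take.
Qed.

(** Hinge sums turn the partial sums of the decreasing rearrangement, which
depend on a sorting permutation, into plain sums over all coordinates: as a
function of [j], [sum_largest x j] is the Legendre dual
[min_t (j t + excess x t)] of the excess. *)
Definition excess {R : realType} {n : nat} (x : 'rV[R]_n) (t : R) : R :=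
  \sum_i Num.max (x 0 i - t) 0.

Lemma excess_decr {R : realType} {n : nat} (x : 'rV[R]_n) (t : R) (j : nat) :
  (j <= n)%N -> excess x t =
  \sum_(0 <= k < j) Num.max (nth 0 (decr x) k - t) 0 +
  \sum_(j <= k < n) Num.max (nth 0 (decr x) k - t) 0.
Proof.
move=> jn; rewrite /excess -(big_decr x (fun u => Num.max (u - t) 0)).
by rewrite (big_nth 0) size_decr (big_cat_nat (leq0n j) jn).
Qed.

(** Each of the [j] chosen entries [u] is at most [t + max (u - t) 0], and the
hinge terms left out are nonnegative. *)
Lemma sum_largest_le_excess {R : realType} {n : nat} (x : 'rV[R]_n) (j : nat)
    (t : R) :
  (j <= n)%N -> sum_largest x j <= t *+ j + excess x t.
Proof.
move=> jn; rewrite sum_largest_nth// (excess_decr x t _ jn) addrA.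
rewrite -[leLHS]addr0 lerD//; last first.
  by apply: sumr_ge0 => k _; rewrite le_max lexx orbT.
rewrite -[t *+ j](_ : \sum_(0 <= k < j) t = _); last first.
  by rewrite sumr_const_nat subn0.
rewrite -big_split/=; apply: ler_sum => k _.
by rewrite -lerBlDl le_max lexx.
Qed.

(** At the threshold given by the [j]-th largest entry both losses in the
previous bound vanish: the first [j] entries are above it, the others below. *)
Lemma sum_largest_eq_excess {R : realType} {n : nat} (x : 'rV[R]_n) (j : nat) :
  (1 <= j <= n)%N ->
  sum_largest x j =
    nth 0 (decr x) j.-1 *+ j + excess x (nth 0 (decr x) j.-1).
Proof.
case: j => // j /= jn; set t := nth 0 (decr x) j.
rewrite sum_largest_nth// (excess_decr x t _ jn).
rewrite [X in _ + (_ + X)]big_nat [X in _ + (_ + X)]big1 ?addr0; last first.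
  move=> k /andP[jk kn]; apply/max_idPr; rewrite subr_le0.
  by rewrite decr_sorted// kn (ltnW jk).
rewrite -[t *+ j.+1](_ : \sum_(0 <= k < j.+1) t = _); last first.
  by rewrite sumr_const_nat subn0.
rewrite -big_split/= !big_nat; apply: eq_bigr => k /andP[_ kj].
have tk : t <= nth 0 (decr x) k by rewrite decr_sorted// -ltnS kj.
by rewrite (elimT max_idPl) ?subr_ge0// addrC subrK.
Qed.

(** For each [j], take the threshold that is optimal for [y]; for [x] it still
gives an upper bound. *)
Lemma majorized_excess {R : realType} {n : nat} (x y : 'rV[R]_n) :
  (forall t, excess x t <= excess y t) -> \sum_i x 0 i = \sum_i y 0 i ->
  majorized x y.
Proof.
move=> xy sumxy; split=> // j jn; rewrite (sum_largest_eq_excess y j jn).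
have /andP[_ jn'] := jn.
exact: le_trans (sum_largest_le_excess x j _ jn') (lerD (lexx _) (xy _)).
Qed.

(** Abel summation in inductive form: replacing every weight by the last,
smallest one loses, because the partial sums it multiplies are nonnegative. *)
Lemma sum_mul_ge_abel {R : realType} (n : nat) (s u : nat -> R) :
  (forall i j, (i <= j <= n)%N -> s j <= s i) ->
  (forall j, (j <= n)%N -> 0 <= \sum_(0 <= k < j) u k) ->
  s n * \sum_(0 <= k < n.+1) u k <= \sum_(0 <= k < n.+1) s k * u k.
Proof.
elim: n => [|n IHn] sdecr usum; first by rewrite !big_nat1.
rewrite big_nat_recr// [leRHS]big_nat_recr//= mulrDr lerD2r.
apply: (@le_trans _ _ (s n * \sum_(0 <= k < n.+1) u k)).
  by rewrite ler_wpM2r// ?usum// sdecr// leqnSn leqnn.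
apply: IHn => [i j /andP[ij jn]|j jn]; first by rewrite sdecr// ij (leqW jn).
by rewrite usum// leqW.
Qed.

(** With [p] and [q] the decreasing rearrangements of [x] and [y], write
[q ^ 2 - p ^ 2 = 2 p (q - p) + (q - p) ^ 2]. Majorization says that [q - p] has
nonnegative partial sums and total [0], so Abel summation against the
decreasing sequence [p] makes the first term sum to something nonnegative. *)
Lemma majorized_dotp_le {R : realType} {n : nat} (x y : 'rV[R]_n) :
  majorized x y -> dotp x x <= dotp y y.
Proof.
move=> [xyle xysum].
case: n => [|n] in x y xyle xysum *; first by rewrite /dotp !big_ord0.
have sq (z : 'rV[R]_n.+1) : dotp z z =
    \sum_(0 <= k < n.+1) nth 0 (decr z) k * nth 0 (decr z) k.
  have := big_decr z (fun u => u * u).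
  by rewrite (big_nth 0) size_decr.
have tot (z : 'rV[R]_n.+1) :
    \sum_(0 <= k < n.+1) nth 0 (decr z) k = \sum_i z 0 i.
  by have := big_decr z id; rewrite (big_nth 0) size_decr.
pose p k := nth 0 (decr x) k; pose q k := nth 0 (decr y) k.
have := @sum_mul_ge_abel R n p (fun k => q k - p k).
rewrite sumrB !tot xysum subrr mulr0 => abel.
have {}abel : 0 <= \sum_(0 <= k < n.+1) p k * (q k - p k).
  apply: abel => [i j ijn|[|j] jn]; [exact: decr_sorted|by rewrite big_geq|].
  rewrite sumrB subr_ge0 -!sum_largest_nth ?(leqW jn)//.
  by rewrite xyle// (leqW jn).
rewrite !sq -subr_ge0 -sumrB.
rewrite (eq_bigr (fun k => p k * (q k - p k) *+ 2 + (q k - p k) ^+ 2)).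
  rewrite big_split/= sumrMnl addr_ge0 ?mulrn_wge0//.
  by apply: sumr_ge0 => k _; exact: sqr_ge0.
by move=> k _; rewrite -/(p k) -/(q k); ring.
Qed.

(** * The nearest point of the permutahedron *)

(** The first-order optimality condition: moving from [x] towards [c] by a
fraction [t] changes the squared distance by [- 2 t A + t ^ 2 B], with [A] the
scalar product below and [B] the squared length of [c - x]. *)
Lemma projection_dotp_le {R : realType} {n : nat} (a b x c : 'rV[R]_n) :
  (forall y, permutahedron b y -> dotp (a - x) (a - x) <= dotp (a - y) (a - y)) ->
  permutahedron b x -> permutahedron b c -> dotp (a - x) (c - x) <= 0.
Proof.
move=> xmin Px Pc; rewrite leNgt; apply/negP.
set A := dotp _ _ => A0; set B := dotp (c - x) (c - x).
have B0 : 0 <= B by exact: dotp_ge0.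
have AB0 : 0 < A + B by lra.
(* Any [t] in [(0, 1]] with [t B < 2 A] would do; this one is at most [1] and
   makes sense even if [B = 0]. *)
pose t := A / (A + B).
have t0 : 0 < t by rewrite divr_gt0.
have t01 : 0 <= t <= 1 by rewrite ltW// ler_pdivrMr// mul1r lerDl.
have := xmin _ (permutahedron_conv b c x t t01 Pc Px).
have -> : a - (t *: c + (1 - t) *: x) = (a - x) - t *: (c - x).
  by apply/rowP => i; rewrite !mxE; ring.
rewrite [leRHS]dotpBr !(dotpBl (a - x)) !dotpZr !dotpZl.
rewrite (dotpC (c - x) (a - x)) -/A -/B => le.
have : t * (A + A - t * B) <= 0 by move: le; lra.
rewrite pmulr_rle0// => {}le.
have tB : t * B <= A.
  by rewrite /t mulrAC ler_pdivrMr// mulrDr lerDr mulr_ge0// ltW.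
lra.
Qed.

Lemma dotp_indicator {R : realType} {n : nat} (S : {set 'I_n}) (x : 'rV[R]_n) :
  dotp (\row_i (i \in S)%:R) x = \sum_(i in S) x 0 i.
Proof.
rewrite [RHS]big_mkcond; apply: eq_bigr => i _; rewrite mxE.
by case: (i \in S); rewrite ?mul1r ?mul0r.
Qed.

(** A maximizer of [w] over the finitely many permutations of [b] is ordered
like [w], as otherwise a transposition would improve it. *)
Lemma exists_maximizing_perm {R : realType} {n : nat} (b w : 'rV[R]_n) :
  exists2 s : 'S_n,
    (forall c, permutahedron b c -> dotp w c <= dotp w (col_perm s b)) &
    forall i j, w 0 j < w 0 i -> (col_perm s b) 0 j <= (col_perm s b) 0 i.
Proof.
case: (@arg_maxP _ R _ (1%g : 'S_n) xpredT (fun s => dotp w (col_perm s b)) isT).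
move=> s _ smax; exists s.
  by apply: permutahedron_dotp_le => u; exact: smax.
move=> i j wji; rewrite leNgt; apply/negP => bij.
have := smax (tperm i j * s)%g isT; rewrite /= col_permM leNgt => /negP; apply.
rewrite -subr_gt0 dotp_tperm nmulr_rgt0 ?subr_lt0//.
Qed.

(** If every entry of [b] placed on [S] is at least every entry placed off [S],
then [S] already receives the largest entries of [b]. The least entry on [S]
serves as a threshold [m]: relative to it the entries on [S] sum to the whole
excess of [b] over [m], which no other arrangement can exceed. *)
Lemma separating_perm_sum_le {R : realType} {n : nat} (b : 'rV[R]_n)
    (s : 'S_n) (S : {set 'I_n}) :
  (forall i j, i \in S -> j \notin S ->
    (col_perm s b) 0 j <= (col_perm s b) 0 i) ->
  forall c, permutahedron b c ->
  \sum_(i in S) c 0 i <= \sum_(i in S) (col_perm s b) 0 i.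
Proof.
move=> sep c Pc; have [->|[i0 i0S]] := set_0Vmem S; first by rewrite !big_set0.
rewrite -!dotp_indicator; apply: permutahedron_dotp_le Pc => u.
rewrite !dotp_indicator.
case: (@arg_minP _ R _ i0 (mem S) (fun i => (col_perm s b) 0 i) i0S) => i1 i1S.
set m := (col_perm s b) 0 i1 => mmin.
have exc (v : 'S_n) : excess (col_perm v b) m = excess b m.
  rewrite /excess [RHS](reindex_inj (@perm_inj _ v)).
  by apply: eq_bigr => i _; rewrite mxE.
have split_m (x : 'rV[R]_n) :
    \sum_(i in S) x 0 i = m *+ #|S| + \sum_(i in S) (x 0 i - m).
  by rewrite sumrB sumr_const addrC subrK.
rewrite !split_m lerD2l.
have -> : \sum_(i in S) ((col_perm s b) 0 i - m) = excess b m.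
  rewrite -(exc s) /excess [RHS](bigID (mem S))/= [X in _ + X]big1 ?addr0.
    apply: eq_bigr => i iS; rewrite (elimT max_idPl)// subr_ge0.
    exact: mmin.
  move=> i iS; apply/max_idPr; rewrite subr_le0; exact: sep.
rewrite -(exc u) /excess [leRHS](bigID (mem S))/= -[leLHS]addr0 lerD//.
  by apply: ler_sum => i _; rewrite le_max lexx.
by apply: sumr_ge0 => i _; rewrite le_max lexx orbT.
Qed.

(** A maximizer [x] of the linear form [d] over the permutahedron also
maximizes the sum over each superlevel set [S] of [d]. Lowering [d] on [S] by
a small [e] keeps it larger on [S] than off [S], so a permutation [s] of [b]
maximizing the lowered form also maximizes the indicator of [S]. Comparing
[x] with [s] under [d] and under the lowered form, the difference of the two
inequalities is [e] times the claim. *)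
Lemma projection_superlevel_sum {R : realType} {n : nat} (b d x : 'rV[R]_n)
    (t : R) :
  permutahedron b x ->
  (forall c, permutahedron b c -> dotp d c <= dotp d x) ->
  forall c, permutahedron b c ->
  \sum_(i | t < d 0 i) c 0 i <= \sum_(i | t < d 0 i) x 0 i.
Proof.
move=> Px xmax c Pc; pose S := [set i | t < d 0 i]%SET.
have toS (z : 'rV[R]_n) :
    \sum_(i | t < d 0 i) z 0 i = dotp (\row_i (i \in S)%:R) z.
  by rewrite dotp_indicator; apply: eq_bigl => i; rewrite inE.
rewrite !toS; set oneS := \row_i _.
have [e e0 egap] : exists2 e, 0 < e & forall i, i \in S -> t + e < d 0 i.
  have [S0|[i0 i0S]] := set_0Vmem S.
    by exists 1 => // i; rewrite S0 inE.
  case: (@arg_minP _ R _ i0 (mem S) (fun i => d 0 i) i0S) => i1 i1S i1min.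
  have t1 : t < d 0 i1 by have : i1 \in S by []; rewrite inE.
  (* Half of the least gap, so that the lowered values stay above [t]. *)
  exists ((d 0 i1 - t) / 2) => [|i /i1min d1]; first by lra.
  by apply: lt_le_trans d1; lra.
have [s smax ssep] := exists_maximizing_perm b (d - e *: oneS).
have sS : dotp oneS c <= dotp oneS (col_perm s b).
  rewrite !dotp_indicator; apply: separating_perm_sum_le Pc => i j iS jS.
  apply: ssep; rewrite !mxE iS (negbTE jS) mulr0 mulr1 subr0.
  have := egap i iS; move: jS; rewrite inE -leNgt; lra.
apply: le_trans sS _.
have := xmax _ (permutahedron_vertex b s); have := smax _ Px.
rewrite !(dotpBl d) !dotpZl => h1 h2.
by rewrite -(ler_pM2l e0); lra.
Qed.

(** Let [S] be the set where [a - x] exceeds [t]. The excess of [a - x] is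
the sum over [S] of [a - x - t]; since [c] has at most the sum of [x] on [S],
this is at most the sum over [S] of [a - c - t], hence at most the excess of
[a - c]. *)
Lemma projection_majorized {R : realType} {n : nat} (a b x : 'rV[R]_n) :
  permutahedron b x ->
  (forall c, permutahedron b c -> dotp (a - x) (c - x) <= 0) ->
  forall c, permutahedron b c -> majorized (a - x) (a - c).
Proof.
move=> Px var c Pc; apply: majorized_excess => [t|]; last first.
  under eq_bigr do rewrite mxE; under [RHS]eq_bigr do rewrite mxE.
  rewrite !big_split/=; congr (_ + _).
  under eq_bigr do rewrite mxE; under [RHS]eq_bigr do rewrite mxE.
  rewrite !sumrN.
  by rewrite (permutahedron_sum b x Px) (permutahedron_sum b c Pc).
have sumS : \sum_(i | t < (a - x) 0 i) c 0 i <= \sum_(i | t < (a - x) 0 i) x 0 i.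
  apply: projection_superlevel_sum Pc => // y Py.
  by rewrite -subr_le0 -dotpBr var.
rewrite /excess [leLHS](bigID (fun i => t < (a - x) 0 i))/=.
rewrite [X in _ + X]big1 ?addr0; last first.
  by move=> i dt; apply/max_idPr; rewrite subr_le0 leNgt.
rewrite [leRHS](bigID (fun i => t < (a - x) 0 i))/= -[leLHS]addr0 lerD//; last first.
  by apply: sumr_ge0 => i _; rewrite le_max lexx orbT.
apply: (@le_trans _ _ (\sum_(i | t < (a - x) 0 i) ((a - c) 0 i - t))); last first.
  by apply: ler_sum => i _; rewrite le_max lexx.
rewrite -subr_ge0 -sumrB.
rewrite (eq_bigr (fun i => x 0 i - c 0 i)) ?sumrB ?subr_ge0// => i ti.
rewrite (elimT max_idPl) ?subr_ge0 ?ltW//.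
by rewrite !mxE; ring.
Qed.

(** The hypothesis on the scalar product gives
[|a - y|^2 >= |a - x|^2 + |y - x|^2]. *)
Lemma projection_unique {R : realType} {n : nat} (a b x y : 'rV[R]_n) :
  permutahedron b y ->
  dotp (a - x) (y - x) <= 0 -> dotp (a - y) (a - y) <= dotp (a - x) (a - x) ->
  y = x.
Proof.
move=> Py var le; apply/eqP; rewrite -subr_eq0; apply/eqP/dotp_le0_eq0.
move: le; have -> : a - y = (a - x) - (y - x) by rewrite opprB addrA subrK.
rewrite [leLHS]dotpBr !(dotpBl (a - x)) (dotpC (y - x) (a - x)); lra.
Qed.

Theorem theorem2p10 (R : realType) (n : nat) (a b : 'rV[R]_n)
    (hb : injective (b 0)) (ha : ~ permutahedron b a) (chat : 'rV[R]_n) :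
  ((permutahedron b chat /\
    forall c, permutahedron b c -> majorized (a - chat) (a - c))
   <->
   argmin (permutahedron b) (fun c => norm2 (a - c)) = [set chat])
  /\
  (argmin (permutahedron b) (fun c => norm2 (a - c)) = [set chat] ->
   forall i j : 'I_n, a 0 i <= a 0 j -> chat 0 i <= chat 0 j).
Proof.
have argminP : argmin (permutahedron b) (fun c => norm2 (a - c)) = [set chat] ->
    permutahedron b chat /\ forall c, permutahedron b c ->
      dotp (a - chat) (a - chat) <= dotp (a - c) (a - c).
  move=> E; have [Pc cmin] : argmin (permutahedron b)
    (fun c => norm2 (a - c)) chat by rewrite E.
  by split=> // c /cmin; rewrite ler_norm2.
split; [split=> [[Pc maj]|/argminP[Pc cmin]]|].
- have cmin y : permutahedron b y ->
      dotp (a - chat) (a - chat) <= dotp (a - y) (a - y).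
    by move=> /maj /majorized_dotp_le.
  apply/seteqP; split=> [y [Py ymin]|_ ->].
    apply: (projection_unique a b chat y Py).
      exact: projection_dotp_le Py.
    by have := ymin _ Pc; rewrite ler_norm2.
  by split=> // y Py; rewrite ler_norm2 cmin.
- split=> //; apply: projection_majorized => // c.
  exact: projection_dotp_le.
- move=> E i j aij; have [Pc cmin] := argminP E.
  rewrite leNgt; apply/negP => cji.
  (* Swapping the two coordinates of [chat] keeps it in the permutahedron and
     does not increase the distance to [a], so by uniqueness nothing moved. *)
  pose y := col_perm (tperm i j) chat.
  have Py : permutahedron b y by exact: permutahedron_col_perm.
  have yc : y = chat.
    apply: (projection_unique a b chat y Py).
      exact: projection_dotp_le Py.
    have swap := dotp_tperm a chat i j.
    have gain : 0 <= (a 0 j - a 0 i) * (chat 0 i - chat 0 j).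
      by rewrite mulr_ge0 ?subr_ge0// ltW.
    have yy : dotp y y = dotp chat chat by exact: dotp_col_perm.
    rewrite !(dotpBr _ a) !dotpBl yy (dotpC y a) (dotpC chat a).
    by rewrite -/y in swap; lra.
  have := congr1 (fun z : 'rV[R]_n => z 0 i) yc.
  by rewrite mxE tpermL => cij; rewrite cij ltxx in cji.
Qed.
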